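(* Let $K$ be a field, let $A=\begin{pmatrix}a&b\\c&d\end{pmatrix}$ be a $2\times 2$ matrix over $K$, let $k\geq 1$ be an integer, and denote the entries of $A^k$ by $A^{k}=\begin{pmatrix}a_k&b_k\\c_k&d_k\end{pmatrix}$. Then \begin{align*} a_{k}&=\operatorname{Trace} S^kA-d\,\operatorname{Trace} S^{k-1}A,\\ b_k&=b\,\operatorname{Trace} S^{k-1}A,\\ c_k&=c\,\operatorname{Trace} S^{k-1}A,\\ d_k&=\operatorname{Trace} S^kA-a\,\operatorname{Trace} S^{k-1}A. \end{align*} Hence $$A^k=\begin{pmatrix} \operatorname{Trace} S^kA-d\,\operatorname{Trace} S^{k-1}A & b\,\operatorname{Trace} S^{k-1}A\\ c\,\operatorname{Trace} S^{k-1}A &\operatorname{Trace} S^kA-a\,\operatorname{Trace} S^{k-1}A \end{pmatrix}.$$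
   Context: For an integer $k\ge 0$, $S^kK^2$ denotes the $K$-vector space of homogeneous polynomials of degree $k$ in two variables $x,y$, with basis $P_j(x,y)=x^{k-j}y^{j}$, $0\le j\le k$. For $A=\begin{pmatrix}a&b\\c&d\end{pmatrix}$, the $k$-th symmetric power $S^kA$ is the matrix, with respect to this basis, of the linear map $S^kK^2\to S^kK^2$ given by $(A\cdot P)(x,y)=P(ax+cy,\,bx+dy)$. In particular $S^0K^2=K$ (constants), $S^0A$ is the identity, and $\operatorname{Trace} S^0A=1$. *)

(* Defs.v *)
From HB Require Import structures.
From mathcomp Require Import all_boot all_order all_algebra.
From mathcomp Require Export mpoly.

Set Implicit Arguments.
Unset Strict Implicit.
Unset Printing Implicit Defensive.

Import GRing.Theory.
Local Open Scope ring_scope.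

Definition mx2 (K : fieldType) (a b c d : K) : 'M[K]_2 :=
  \matrix_(i < 2, j < 2)
    if i == 0 then (if j == 0 then a else b) else (if j == 0 then c else d).

Section SymmetricPower.

Variables (K : fieldType) (k : nat).

(* The variables x and y are 'X_0 and 'X_1 in {mpoly K[2]}. *)

Lemma sympow_monom_homog (j : 'I_k.+1) :
  'X_0 ^+ (k - j) * 'X_1 ^+ j \is [in K[2], k.-homog].
Proof.
have -> : k.-homog = (1 * (k - j) + 1 * j).-homog :> qualifier _ {mpoly K[2]}.
  by rewrite !mul1n subnK // -ltnS.
by apply: dhomogM; apply: dhomogMn; rewrite dhomogX /= mdeg1.
Qed.

Definition sympow_basis : k.+1.-tuple (dhomog 2 K k) :=
  [tuple DHomog (sympow_monom_homog j) | j < k.+1].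

Variable A : 'M[K]_2.

Definition sympow_subst : 2.-tuple {mpoly K[2]} :=
  [tuple A 0 0 *: 'X_0 + A 1 0 *: 'X_1; A 0 1 *: 'X_0 + A 1 1 *: 'X_1].

Lemma sympow_act_homog (p : dhomog 2 K k) :
  (val p) \mPo sympow_subst \is [in K[2], k.-homog].
Proof.
case: p => p /= /dhomogP hp; rewrite comp_mpolyE big_seq.
apply: rpred_sum => m mp; apply: rpredZ.
have -> : k = (1 * m 0%R + 1 * m 1%R)%N.
  rewrite -(hp m mp) -[LHS]/(mdeg m) mdegE !big_ord_recl big_ord0 addn0 !mul1n.
  by congr (m _ + m _)%N; apply: val_inj.
rewrite !big_ord_recl big_ord0 mulr1.
have <- : 0 = ord0 :> 'I_2 by apply: val_inj.
have <- : 1 = lift ord0 ord0 :> 'I_2 by apply: val_inj.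
by apply: dhomogM; apply: dhomogMn; rewrite !(tnth_nth 0) /=;
  apply: rpredD; apply: rpredZ; rewrite dhomogX /= mdeg1.
Qed.

Definition sympow_act (p : dhomog 2 K k) : dhomog 2 K k :=
  DHomog (sympow_act_homog p).

Lemma sympow_act_is_linear : linear sympow_act.
Proof. by move=> u p q; apply: val_inj; rewrite /= linearP. Qed.

HB.instance Definition _ :=
  GRing.isLinear.Build K (dhomog 2 K k) (dhomog 2 K k) _ sympow_act
    sympow_act_is_linear.

Definition sympow : 'M[K]_k.+1 :=
  \matrix_(i, j) coord sympow_basis i (sympow_act (tnth sympow_basis j)).

End SymmetricPower.

Lemma sympow_basisE (K : fieldType) (k : nat) (j : 'I_k.+1) :
  val (sympow_basis K k)`_j = 'X_0 ^+ (k - j) * 'X_1 ^+ j.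
Proof. by rewrite -tnth_nth tnth_mktuple. Qed.

(* [coord] is only meaningful for a free family. *)
Lemma sympow_basis_basis (K : fieldType) (k : nat) :
  basis_of fullv (sympow_basis K k).
Proof.
rewrite basisEfree subvf size_tuple /= andbC.
have -> : (\dim {: dhomog 2 K k} <= k.+1)%N.
  by rewrite dimvf /dim /= addn1 binSn.
apply/(@freeP _ _ _ (sympow_basis K k)) => u /(congr1 val) h i; move: h.
rewrite raddf_sum /= => h.
have /(congr1 (mcoeff (U_(0%R) *+ (k - i) + U_(1%R) *+ i)%MM)) := h.
rewrite raddf_sum mcoeff0 /= (bigD1 i) //= big1 ?addr0 => [|j ji].
  by rewrite sympow_basisE mcoeffZ !mpolyXn -mpolyXD mcoeffX eqxx mulr1.
rewrite sympow_basisE mcoeffZ !mpolyXn -mpolyXD mcoeffX.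
case: eqP => [/mnmP /(_ 1)|]; last by rewrite mulr0.
rewrite !mnmDE !mulmnE !mnm1E /= !mul0n !mul1n !add0n => e.
by case/eqP: ji; apply: val_inj.
Qed.

Lemma sympow_actE (K : fieldType) (k : nat) (A : 'M[K]_2) (j : 'I_k.+1) :
  sympow_act A (sympow_basis K k)`_j =
  \sum_i sympow k A i j *: (sympow_basis K k)`_i.
Proof.
rewrite [LHS](coord_basis (sympow_basis_basis K k) (memvf _)).
by apply: eq_bigr => i _; rewrite mxE (tnth_nth 0).
Qed.

(* Main.v *)
Require Import Defs.
From mathcomp Require Import all_boot all_order all_algebra.
From mathcomp Require Import ring.
Import GRing.Theory.
Local Open Scope ring_scope.

(** Write t_k for the trace of S^k A.  Multiplying the claimed expression of
    A ^+ k by A gives that of A ^+ k.+1 as soon as the traces satisfy the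
    recurrence that Cayley-Hamilton imposes on the powers of A,
    t_(k+2) = (a + d) t_(k+1) - (a d - b c) t_k, with t_0 = 1 and t_1 = a + d
    ([mxtrace_sympowSS], [mx2_expS]).

    Triangularizing A would identify t_k with the complete homogeneous
    symmetric polynomial of the eigenvalues, but the recurrence has a direct
    proof over K.  Setting x = 1 and y = 'X makes S^k A explicit: its (i, j)
    entry is the coefficient of 'X^i in p ^+ (k - j) * q ^+ j, where
    p = a + c 'X and q = b + d 'X ([sympow_coef]).  So t_k is a diagonal sum of
    coefficients ([diag_sum]).  Let e_k be the neighbouring sum, where the
    coefficient is read one degree lower.  Peeling a factor p off the terms of
    t_(k+1), and a factor q off those of e_(k+1), gives
    t_(k+1) = a t_k + c e_k + d^(k+1)  and  e_(k+1) = b t_k + d e_k;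
    eliminating e from these gives the recurrence. *)

(** The factor r is 1 for the diagonal, and 'X for the diagonal just above it,
    on which coefficients are read one degree lower, the one of degree -1
    being 0. *)
Definition diag_sum (R : comNzRingType) (r p q : {poly R}) (k : nat) : R :=
  \sum_(j < k.+1) (r * (p ^+ (k - j) * q ^+ j))`_j.

Arguments diag_sum {R}.

Section DiagSum.

Variables (R : comNzRingType) (a b c d : R).

Let p : {poly R} := a%:P + c *: 'X.
Let q : {poly R} := b%:P + d *: 'X.

Lemma coef_linear_exp (n : nat) : (q ^+ n)`_n = d ^+ n.
Proof.
have size_q : (size q <= 2)%N.
  rewrite (leq_trans (size_polyD _ _)) // geq_max.
  rewrite (leq_trans (size_polyC_leq1 _)) //=.
  by rewrite (leq_trans (size_scale_leq _ _)) ?size_polyX.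
elim: n => [|n IHn]; first by rewrite !expr0 coef1.
rewrite exprS mulrDl coefD mul_polyC coefZ -scalerAl coefZ coefXM /= IHn.
rewrite nth_default ?mulr0 ?add0r ?exprS // (leq_trans (size_poly_exp_leq _ _)) //.
rewrite ltnS -[leqRHS]mul1n leq_mul //.
by case: (size q) size_q.
Qed.

(** Each term but the last has a factor p to expand; the last one is the top
    coefficient of q ^+ k.+1. *)
Lemma diag_sumS (k : nat) :
  diag_sum 1 p q k.+1 =
  a * diag_sum 1 p q k + c * diag_sum 'X p q k + d ^+ k.+1.
Proof.
rewrite /diag_sum big_ord_recr /= subnn expr0 !mul1r coef_linear_exp.
congr (_ + _); rewrite !mulr_sumr -big_split /=; apply: eq_bigr => j _.
rewrite !mul1r subSn -1?ltnS // exprS -mulrA {1}/p mulrDl coefD mul_polyC.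
by rewrite -scalerAl !coefZ.
Qed.

(** The first term vanishes, and each of the others has a factor q to expand;
    cancelling the prefactor 'X makes the indices fall back into step. *)
Lemma diag_sumXS (k : nat) :
  diag_sum 'X p q k.+1 = b * diag_sum 1 p q k + d * diag_sum 'X p q k.
Proof.
rewrite /diag_sum big_ord_recl coefXM /= add0r.
rewrite !mulr_sumr -big_split /=; apply: eq_bigr => j _.
rewrite coefXM /= /bump /= add1n subSS exprS mulrCA {1}/q mulrDl coefD.
by rewrite mul_polyC -scalerAl !coefZ mul1r.
Qed.

Lemma diag_sum0 : diag_sum 1 p q 0 = 1.
Proof. by rewrite /diag_sum big_ord1 !mul1r coef1. Qed.

Lemma diag_sumX0 : diag_sum 'X p q 0 = 0.
Proof. by rewrite /diag_sum big_ord1 coefXM. Qed.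

Lemma diag_sum1 : diag_sum 1 p q 1 = a + d.
Proof. by rewrite diag_sumS diag_sum0 diag_sumX0 mulr1 mulr0 addr0 expr1. Qed.

Lemma diag_sumSS (k : nat) :
  diag_sum 1 p q k.+2 =
  (a + d) * diag_sum 1 p q k.+1 - (a * d - b * c) * diag_sum 1 p q k.
Proof.
by rewrite (diag_sumS k.+1) diag_sumXS (diag_sumS k) [d ^+ _.+2]exprS; ring.
Qed.

End DiagSum.

Section Sympow.

Variables (K : fieldType) (A : 'M[K]_2).

Let p : {poly K} := (A 0 0)%:P + A 1 0 *: 'X.
Let q : {poly K} := (A 0 1)%:P + A 1 1 *: 'X.

Let h : 'I_2 -> {poly K} := tnth [tuple 1; 'X].

(** The substitution x = 1, y = 'X is a ring morphism that sends the j-th basis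
    monomial to 'X^j, so it reads off coordinates in S^k as coefficients; it
    sends the image of x under A to p and that of y to q. *)
Lemma sympow_coef (k : nat) (i j : 'I_k.+1) :
  sympow k A i j = (p ^+ (k - j) * q ^+ j)`_i.
Proof.
have hX0 : mmap polyC h 'X_0 = 1 by rewrite mmapX mmap1U.
have hX1 : mmap polyC h 'X_1 = 'X by rewrite mmapX mmap1U.
have hP (l : 'I_k.+1) (x : K) :
    mmap polyC h (val (x *: (sympow_basis K k)`_l)) = x *: 'X^l.
  have -> : val (x *: (sympow_basis K k)`_l) = x *: val (sympow_basis K k)`_l.
    by [].
  rewrite mmapZ mul_polyC sympow_basisE.
  by rewrite rmorphM !rmorphXn /= hX0 hX1 expr1n mul1r.
have hAP :
    mmap polyC h (val (sympow_act A (sympow_basis K k)`_j)) =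
    p ^+ (k - j) * q ^+ j.
  rewrite [val _]/= sympow_basisE !(rmorphM, rmorphXn) /= !comp_mpolyXU /=.
  by rewrite !mmapD !mmapZ hX0 hX1 !mulr1 !mul_polyC.
rewrite -hAP sympow_actE (raddf_sum (val : dhomog 2 K k -> {mpoly K[2]})).
rewrite raddf_sum coef_sum (bigD1 i) //= big1 ?addr0 => [|l li].
  by rewrite hP coefZ coefXn eqxx mulr1.
by rewrite hP coefZ coefXn (inj_eq val_inj) eq_sym (negPf li) mulr0.
Qed.

Lemma mxtrace_sympow (k : nat) : \tr (sympow k A) = diag_sum 1 p q k.
Proof. by apply: eq_bigr => j _; rewrite sympow_coef mul1r. Qed.

Lemma mxtrace_sympow0 : \tr (sympow 0 A) = 1.
Proof. by rewrite mxtrace_sympow diag_sum0. Qed.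

Lemma mxtrace_sympow1 : \tr (sympow 1 A) = A 0 0 + A 1 1.
Proof. by rewrite mxtrace_sympow diag_sum1. Qed.

Lemma mxtrace_sympowSS (k : nat) :
  \tr (sympow k.+2 A) =
  (A 0 0 + A 1 1) * \tr (sympow k.+1 A)
  - (A 0 0 * A 1 1 - A 0 1 * A 1 0) * \tr (sympow k A).
Proof. by rewrite !mxtrace_sympow diag_sumSS. Qed.

End Sympow.

Lemma mx2M (K : fieldType) (a b c d a' b' c' d' : K) :
  mx2 a b c d * mx2 a' b' c' d' =
  mx2 (a * a' + b * c') (a * b' + b * d') (c * a' + d * c') (c * b' + d * d').
Proof.
apply/matrixP => i j; rewrite !mxE !big_ord_recl big_ord0 !mxE addr0 /=.
by case: (i == 0); case: (j == 0).
Qed.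

Lemma mx2_expS (K : fieldType) (a b c d : K) (k : nat) :
  let A := mx2 a b c d in
  A ^+ k.+1 = mx2 (\tr (sympow k.+1 A) - d * \tr (sympow k A))
                  (b * \tr (sympow k A))
                  (c * \tr (sympow k A))
                  (\tr (sympow k.+1 A) - a * \tr (sympow k A)).
Proof.
move=> A; elim: k => [|k IHk].
  rewrite mxtrace_sympow0 mxtrace_sympow1 !mxE /= expr1.
  by congr mx2; ring.
rewrite exprS IHk mx2M mxtrace_sympowSS !mxE /=.
by congr mx2; ring.
Qed.

Theorem theorem3p5 (K : fieldType) (a b c d : K) (k : nat) (hk : (1 <= k)%N) :
  let A := mx2 a b c d in
  [/\ (A ^+ k) 0 0 = \tr (sympow k A) - d * \tr (sympow k.-1 A),
      (A ^+ k) 0 1 = b * \tr (sympow k.-1 A),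
      (A ^+ k) 1 0 = c * \tr (sympow k.-1 A) &
      (A ^+ k) 1 1 = \tr (sympow k A) - a * \tr (sympow k.-1 A)]
  /\ A ^+ k = mx2 (\tr (sympow k A) - d * \tr (sympow k.-1 A))
                  (b * \tr (sympow k.-1 A))
                  (c * \tr (sympow k.-1 A))
                  (\tr (sympow k A) - a * \tr (sympow k.-1 A)).
Proof.
case: k hk => // k _ A; have AE := mx2_expS K a b c d k.
by split; [split; rewrite AE mxE | exact: AE].
Qed.
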